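(* Let $G$ be a finite group, let $U$ and $U'$ be projective unitary representations of $G$ on finite-dimensional Hilbert spaces $\mathcal{H}$ (input) and $\mathcal{H}'$ (output), and let $\rho\in\mathcal{S}(\mathcal{H})$ and $\sigma\in\mathcal{S}(\mathcal{H}')$ be states. Then $$R_{G\text{-}\mathrm{cov}}(\rho\to\sigma)=\begin{cases}\infty & \text{if }\mathrm{Sym}(\rho)\subset\mathrm{Sym}(\sigma),\\ 0 & \text{otherwise.}\end{cases}$$
   Context: $\mathcal{S}(\mathcal{H})$ denotes the density operators on $\mathcal{H}$. $\mathrm{Sym}(\rho):=\{g\in G\mid U(g)\rho U(g)^\dagger=\rho\}$ and $\mathrm{Sym}(\sigma):=\{g\in G\mid U'(g)\sigma U'(g)^\dagger=\sigma\}$. On tensor powers the representations are $U(g)^{\otimes n}$ and $U'(g)^{\otimes m}$. A CPTP map $\mathcal{E}:\mathcal{L}(\mathcal{H}^{\otimes n})\to\mathcal{L}(\mathcal{H}'^{\otimes m})$ is $G$-covariant if $\mathcal{E}(U(g)^{\otimes n}LU(g)^{\dagger\otimes n})=U'(g)^{\otimes m}\mathcal{E}(L)U'(g)^{\dagger\otimes m}$ for all $g\in G$ and all $L$. The trace distance is $\mathrm{T}(\rho,\sigma)=\frac12\|\rho-\sigma\|_1$. A rate $r\ge0$ is achievable if there is a sequence of $G$-covariant CPTP maps $\mathcal{E}^{(n)}:\mathcal{L}(\mathcal{H}^{\otimes n})\to\mathcal{L}(\mathcal{H}'^{\otimes\lfloor rn\rfloor})$ with $\lim_{n\to\infty}\mathrm{T}(\mathcal{E}^{(n)}(\rho^{\otimes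 n}),\sigma^{\otimes\lfloor rn\rfloor})=0$, and $R_{G\text{-}\mathrm{cov}}(\rho\to\sigma)\in[0,\infty]$ is the supremum of achievable rates. *)

(* Defs.v *)
From HB Require Import structures.
From mathcomp Require Import all_boot all_order all_fingroup all_algebra.
From mathcomp Require Import all_classical all_reals all_analysis.
From mathcomp Require Import complex.
(* Not imported: its [_ ^t _] notation clashes with the one of sesquilinear. *)
From mathcomp Require mxtens.

Set Implicit Arguments.
Unset Strict Implicit.
Unset Printing Implicit Defensive.

Import Order.TTheory GRing.Theory Num.Theory.
Import numFieldNormedType.Exports.

Local Open Scope complex_scope.
Local Open Scope sesquilinear_scope.
Local Open Scope ring_scope.

(* A finite-dimensional Hilbert space is C^d with its standard
   inner product, and L(C^d) is 'M[R[i]]_d; d = 0 is not excluded here, but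
   C^0 carries no state. The dagger is [_ ^t*]. *)

Notation "A ⊗ B" := (mxtens.tensmx A B)
  (at level 40, left associativity) : ring_scope.
Notation "A ^⊗ n" := (mxtens.ntensmx A n)
  (at level 29, left associativity) : ring_scope.

Section Quantum.
Variable R : realType.
Local Notation C := R[i].

(* On R[i], [0 <= z] means that z is real and nonnegative, so that psd
   matrices are Hermitian. *)
Definition psd d (A : 'M[C]_d) : Prop :=
  forall v : 'cV[C]_d, 0 <= (v ^t* *m A *m v) 0 0.

Definition is_state d (rho : 'M[C]_d) : Prop := psd rho /\ \tr rho = 1.

(* Square root by functional calculus; used for psd matrices only. *)
Definition sqrtmx d (A : 'M[C]_d) : 'M[C]_d :=
  invmx (spectralmx A) *m diag_mx (map_mx sqrtC (spectral_diag A))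
    *m spectralmx A.

(* The trace of sqrt(A^* A) is a nonnegative real number of R[i]; [complex.Re]
   only changes its type. *)
Definition trace_norm d (A : 'M[C]_d) : R :=
  complex.Re (\tr (sqrtmx (A ^t* *m A))).

Definition trace_dist d (rho sigma : 'M[C]_d) : R :=
  2^-1 * trace_norm (rho - sigma).

(* id_k (x) E on L(C^k (x) C^p): E is applied to each of the k * k blocks. *)
Definition ampliation k p q (E : 'M[C]_p -> 'M[C]_q) (X : 'M[C]_(k * p)) :
    'M[C]_(k * q) :=
  \sum_(i < k) \sum_(j < k)
    delta_mx i j ⊗ E (\matrix_(a, b) X (mxtens.mxtens_index (i, a))
                                       (mxtens.mxtens_index (j, b))).

Definition completely_positive p q (E : {linear 'M[C]_p -> 'M[C]_q}) : Prop :=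
  forall (k : nat) (X : 'M[C]_(k * p)), psd X -> psd (ampliation E X).

Definition trace_preserving p q (E : {linear 'M[C]_p -> 'M[C]_q}) : Prop :=
  forall L : 'M[C]_p, \tr (E L) = \tr L.

Definition cptp p q (E : {linear 'M[C]_p -> 'M[C]_q}) : Prop :=
  completely_positive E /\ trace_preserving E.

Section Group.
Variable G : finGroupType.

Definition projective_unitary_rep d (U : G -> 'M[C]_d) : Prop :=
  (forall g, U g \is unitarymx) /\
  exists omega : G -> G -> C,
    (forall g h, `|omega g h| = 1) /\
    (forall g h, U g *m U h = omega g h *: U (g * h)%g).

Definition sym_subgroup d (U : G -> 'M[C]_d) (rho : 'M[C]_d) : {set G} :=
  [set g | U g *m rho *m (U g) ^t* == rho].

Definition covariant d d' (U : G -> 'M[C]_d) (U' : G -> 'M[C]_d') n m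
    (E : 'M[C]_(d ^ n) -> 'M[C]_(d' ^ m)) : Prop :=
  forall g (L : 'M[C]_(d ^ n)),
    E ((U g) ^⊗ n *m L *m ((U g) ^t*) ^⊗ n) =
    (U' g) ^⊗ m *m E L *m ((U' g) ^t*) ^⊗ m.

Local Open Scope classical_set_scope.

Definition achievable_rate d d' (U : G -> 'M[C]_d) (U' : G -> 'M[C]_d')
    (rho : 'M[C]_d) (sigma : 'M[C]_d') (r : R) : Prop :=
  0 <= r /\
  exists E : forall n : nat,
      {linear 'M[C]_(d ^ n) -> 'M[C]_(d' ^ Num.truncn (r * n%:R))},
    (forall n, cptp (E n) /\ covariant U U' (E n)) /\
    trace_dist (E n (rho ^⊗ n)) (sigma ^⊗ Num.truncn (r * n%:R))
      @[n --> \oo] --> (0 : R).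

(* The rate 0 is always achievable for states (by the trace), so the
   supremum is over a nonempty set. *)
Definition conversion_rate d d' (U : G -> 'M[C]_d) (U' : G -> 'M[C]_d')
    (rho : 'M[C]_d) (sigma : 'M[C]_d') : \bar R :=
  ereal_sup [set r%:E | r in [set r : R | achievable_rate U U' rho sigma r]].

End Group.
End Quantum.

(* Main.v *)
(* If g fixes rho but not sigma, a covariant map sends rho^n to a g-invariant
   state, and that cannot approximate sigma^m, since sigma^m and its g-translate
   stay at a distance bounded below.  Otherwise, measure every copy of rho with
   the covariant POVM with effects U(g) rho U(g)^* / |G| (completed to sum to 1),
   elect the group element g obtained most often, ties being broken uniformly,
   and output the g-translate of sigma^m.  Outcome 1 is strictly more likely
   than any g outside Sym(rho), because rho has a strictly larger overlap with
   itself than with its other translates, so by Chernoff the error decays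
   exponentially in n, uniformly in m. *)
From HB Require Import structures.
Require Import Defs.
From mathcomp Require Import all_boot all_order all_fingroup all_algebra.
From mathcomp Require Import all_classical all_reals all_analysis.
From mathcomp Require Import complex ring lra.

Set Implicit Arguments.
Unset Strict Implicit.
Unset Printing Implicit Defensive.

Import Order.TTheory GRing.Theory Num.Theory.
Import numFieldNormedType.Exports.

Local Open Scope complex_scope.
Local Open Scope sesquilinear_scope.
Local Open Scope ring_scope.

(** * Conjugate transposes and Gram matrices *)

Section Adjoint.
Variable C : numClosedFieldType.

Lemma adjmxM m n p (A : 'M[C]_(m, n)) (B : 'M[C]_(n, p)) :
  (A *m B)^t* = B^t* *m A^t*.
Proof. by rewrite trmx_mul map_mxM. Qed.

Lemma adjmxD m n (A B : 'M[C]_(m, n)) : (A + B)^t* = A^t* + B^t*.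
Proof. by rewrite linearD map_mxD. Qed.

Lemma adjmxB m n (A B : 'M[C]_(m, n)) : (A - B)^t* = A^t* - B^t*.
Proof. by rewrite linearB map_mxB. Qed.

Lemma adjmxN m n (A : 'M[C]_(m, n)) : (- A)^t* = - A^t*.
Proof. by apply/matrixP => i j; rewrite !mxE rmorphN. Qed.

Lemma adjmxZ m n (a : C) (A : 'M[C]_(m, n)) : (a *: A)^t* = a^* *: A^t*.
Proof. by rewrite linearZ map_mxZ. Qed.

Lemma adjmx1 n : (1%:M : 'M[C]_n)^t* = 1%:M.
Proof. by rewrite trmx1 map_mx1. Qed.

Lemma mxtrace_adj n (A : 'M[C]_n) : \tr (A^t*) = (\tr A)^*.
Proof. by rewrite /mxtrace rmorph_sum; apply: eq_bigr => i _; rewrite !mxE. Qed.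

Lemma mxtraceB n (A B : 'M[C]_n) : \tr (A - B) = \tr A - \tr B.
Proof. exact: raddfB. Qed.

Lemma mxE_gram m n (A : 'M[C]_(m, n)) j : (A^t* *m A) j j = \sum_i `|A i j| ^+ 2.
Proof. by rewrite mxE; apply: eq_bigr => i _; rewrite !mxE normCKC. Qed.

Lemma gram_eq0 m n (A : 'M[C]_(m, n)) : \tr (A^t* *m A) = 0 -> A = 0.
Proof.
move=> h; apply/matrixP => i j; rewrite mxE.
have := h; rewrite /mxtrace => /eqP.
rewrite psumr_eq0 => [/allP/(_ j)|k _]; last first.
  by rewrite mxE_gram sumr_ge0 // => *; rewrite exprn_ge0.
rewrite mem_index_enum mxE_gram /= => /(_ isT).
rewrite psumr_eq0 => [/allP/(_ i)|k _]; last by rewrite exprn_ge0.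
by rewrite mem_index_enum /= => /(_ isT); rewrite sqrf_eq0 normr_eq0 => /eqP.
Qed.

(** Polarization: basis vectors [e i], [e j] give [A i j + A j i = 0], and replacing [e j] by
    ['i *: e j] gives [A i j = A j i]. *)
Lemma form_eq0 n (A : 'M[C]_n) :
  (forall v : 'cV[C]_n, (v^t* *m A *m v) 0 0 = 0) -> A = 0.
Proof.
move=> h.
have addE (X Y : 'M[C]_1) : (X + Y) 0 0 = X 0 0 + Y 0 0 by rewrite mxE.
have scaleE a (X : 'M[C]_1) : (a *: X) 0 0 = a * X 0 0 by rewrite mxE.
have hs (u v : 'cV[C]_n) :
    (u^t* *m A *m v) 0 0 + (v^t* *m A *m u) 0 0 = 0.
  have := h (u + v); rewrite adjmxD !(mulmxDl, mulmxDr) !addE !h.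
  by rewrite add0r addr0 addrC.
apply/matrixP => i j; rewrite [RHS]mxE.
pose e k : 'cV[C]_n := delta_mx k 0.
have eE k l : ((e k)^t* *m A *m e l) 0 0 = A k l.
  by rewrite /e trmx_delta map_delta_mx -mulmxA -colE -rowE !mxE.
have h1 := hs (e i) (e j); have h2 := hs (e i) ('i *: e j).
move: h1 h2; rewrite adjmxZ -!scalemxAr -!scalemxAl !scaleE !eE conjCi mulNr.
rewrite -mulrBr => h1 /eqP; rewrite mulf_eq0 (negPf (neq0Ci C)) /= subr_eq0 => /eqP h2.
by apply/eqP; move: h1; rewrite -h2 => /eqP; rewrite -mulr2n mulrn_eq0.
Qed.

End Adjoint.

(** * Positive semidefinite matrices *)

Section Positive.
Variable R : realType.
Local Notation C := R[i].

Lemma psd_gram m n (B : 'M[C]_(m, n)) : psd (B^t* *m B).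
Proof.
move=> v; rewrite mulmxA -mulmxA -adjmxM mxE_gram.
by apply: sumr_ge0 => i _; rewrite exprn_ge0.
Qed.

Lemma psd_congr m n (A : 'M[C]_m) (B : 'M[C]_(m, n)) :
  psd A -> psd (B^t* *m A *m B).
Proof. by move=> pA v; rewrite !mulmxA -adjmxM -mulmxA. Qed.

Lemma psdD n (A B : 'M[C]_n) : psd A -> psd B -> psd (A + B).
Proof.
by move=> pA pB v; rewrite mulmxDr mulmxDl mxE addr_ge0.
Qed.

Lemma psd0 n : psd (0 : 'M[C]_n).
Proof. by move=> v; rewrite mulmx0 mul0mx mxE. Qed.

Lemma psd_sum n (I : finType) (P : pred I) (A : I -> 'M[C]_n) :
  (forall i, P i -> psd (A i)) -> psd (\sum_(i | P i) A i).
Proof.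
move=> pA; elim/big_ind: _ => //; [exact: psd0|exact: psdD].
Qed.

Lemma psdZ n (a : C) (A : 'M[C]_n) : 0 <= a -> psd A -> psd (a *: A).
Proof.
by move=> a0 pA v; rewrite -scalemxAr -scalemxAl mxE mulr_ge0.
Qed.

(** Nonnegative elements of [C] are real, so [A^t* - A] has zero quadratic form. *)
Lemma psd_adj n (A : 'M[C]_n) : psd A -> A^t* = A.
Proof.
move=> pA; apply/eqP; rewrite -subr_eq0; apply/eqP/form_eq0 => v.
rewrite mulmxBr mulmxBl.
have -> : v^t* *m A^t* *m v = (v^t* *m A *m v)^t*.
  by rewrite !adjmxM trmxCK mulmxA.
have := pA v; move: (v^t* *m A *m v) => w w0.
by rewrite !mxE; apply/eqP; rewrite subr_eq0; apply/eqP/CrealP/ger0_real.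
Qed.

Lemma psd_diag n (D : 'rV[C]_n) : (forall i, 0 <= D 0 i) -> psd (diag_mx D).
Proof.
move=> D0 v; rewrite -mulmxA mxE sumr_ge0 // => i _.
by rewrite mul_diag_mx !mxE mulrCA -normCKC mulr_ge0 // exprn_ge0.
Qed.

Lemma psd_spectral n (A : 'M[C]_n) : psd A ->
  [/\ A = (spectralmx A)^t* *m diag_mx (spectral_diag A) *m spectralmx A,
      (spectralmx A)^t* *m spectralmx A = 1%:M,
      spectralmx A *m (spectralmx A)^t* = 1%:M &
      forall i, 0 <= spectral_diag A 0 i].
Proof.
move=> pA; set Q := spectralmx A; set D := spectral_diag A.
have QU : Q \is unitarymx by exact: spectral_unitarymx.
have QQ' : Q *m Q^t* = 1%:M by apply/unitarymxP.
have Q'Q : Q^t* *m Q = 1%:M by apply: mulmx1C.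
have nA : A \is normalmx by apply/normalmxP; rewrite psd_adj.
have AE : A = Q^t* *m diag_mx D *m Q.
  by rewrite -invmx_unitary //; apply/orthomx_spectralP.
split=> // i.
have := psd_congr (Q^t*) pA; rewrite trmxCK [X in _ *m X *m _]AE.
rewrite !mulmxA QQ' mul1mx -mulmxA QQ' mulmx1.
move=> /(_ (delta_mx i 0)).
by rewrite trmx_delta map_delta_mx -mulmxA -colE -rowE !mxE eqxx mulr1n.
Qed.

Lemma psd_factor n (A : 'M[C]_n) : psd A -> exists B : 'M[C]_n, A = B^t* *m B.
Proof.
move=> /psd_spectral[AE _ _ D0].
exists (diag_mx (map_mx sqrtC (spectral_diag A)) *m spectralmx A).
rewrite adjmxM tr_diag_mx map_diag_mx mulmxA -[_ *m diag_mx _ *m diag_mx _]mulmxA.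
rewrite mulmx_diag {1}AE; congr (_ *m diag_mx _ *m _).
apply/rowP => i; rewrite !mxE -normCKC ger0_norm ?sqrtC_ge0 //.
by rewrite sqrtCK.
Qed.

Lemma psd_mxtrace_ge0 n (A : 'M[C]_n) : psd A -> 0 <= \tr A.
Proof.
move=> /psd_factor[B ->]; apply: sumr_ge0 => i _.
by rewrite mxE_gram; apply: sumr_ge0 => j _; rewrite exprn_ge0.
Qed.

Lemma psd_mxtrace_mulmx_ge0 n (A B : 'M[C]_n) :
  psd A -> psd B -> 0 <= \tr (A *m B).
Proof.
move=> pA /psd_factor[B' ->]; rewrite mulmxA mxtrace_mulC mulmxA.
by apply/psd_mxtrace_ge0; rewrite -[X in X *m _ *m _]trmxCK; apply: psd_congr.
Qed.

Lemma psd_mxtrace_eq0 n (A : 'M[C]_n) : psd A -> \tr A = 0 -> A = 0.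
Proof. by move=> /psd_factor[B ->] /gram_eq0->; rewrite mulmx0. Qed.

(** Each eigenvalue is at most the sum of all, none being negative. For a state this bounds it by
    the identity, which lets the orbit measurement be completed. *)
Lemma psd_mxtrace_subl n (A : 'M[C]_n) : psd A -> psd ((\tr A)%:M - A).
Proof.
move=> pA; have [AE Q'Q QQ' D0] := psd_spectral pA.
set Q := spectralmx A in AE Q'Q QQ'; set D := spectral_diag A in AE D0.
have trA : \tr A = \sum_i D 0 i.
  rewrite AE mxtrace_mulC mulmxA QQ' mul1mx mxtrace_diag; exact: eq_bigr.
have -> : (\tr A)%:M - A = Q^t* *m diag_mx (const_mx (\tr A) - D) *m Q.
  rewrite linearB /= mulmxBr mulmxBl -AE diag_const_mx.
  by rewrite mul_mx_scalar -scalemxAl Q'Q scalemx1.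
apply/psd_congr/psd_diag => i; rewrite !mxE trA (bigD1 i) //= addrC addKr.
exact: sumr_ge0.
Qed.

End Positive.

(** * Polar decomposition from spectral data *)

Section Polar.
Variable C : numClosedFieldType.

(** The polar factor is [A] times a pseudo-inverse of its absolute value; zeros in [D] make it a
    partial isometry only. *)
Lemma polar_spectral n (A Q : 'M[C]_n) (D : 'rV[C]_n) :
  A^t* *m A = Q^t* *m diag_mx D *m Q -> Q^t* *m Q = 1%:M ->
  Q *m Q^t* = 1%:M -> (forall i, 0 <= D 0 i) ->
  exists V : 'M[C]_n,
  [/\ V *m V^t* *m V = V, V *m (Q^t* *m diag_mx (map_mx sqrtC D) *m Q) = A &
      V^t* *m A = Q^t* *m diag_mx (map_mx sqrtC D) *m Q].
Proof.
move=> AE Q'Q QQ' D0.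
pose S := diag_mx (map_mx sqrtC D) : 'M[C]_n.
(* Since [0^-1 = 0], [T] is the pseudo-inverse of [S], and [Z] projects onto the support. *)
pose T := diag_mx (map_mx (fun x => (sqrtC x)^-1) D) : 'M[C]_n.
pose Z := diag_mx (map_mx (fun x => (x != 0)%:R) D) : 'M[C]_n.
have TS : T *m S = Z.
  rewrite mulmx_diag; congr diag_mx; apply/rowP => i; rewrite !mxE.
  by have [->|nz] := eqVneq (D 0 i) 0; rewrite ?sqrtC0 ?mulr0 // mulVf ?sqrtC_eq0.
have TDT : T *m diag_mx D *m T = Z.
  rewrite !mulmx_diag; congr diag_mx; apply/rowP => i; rewrite !mxE.
  have [->|nz] := eqVneq (D 0 i) 0; rewrite ?mulr0 ?mul0r //.
  by rewrite -[X in _ * X * _]sqrtCK expr2 mulKf ?mulfV ?sqrtC_eq0.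
have TD : T *m diag_mx D = S.
  rewrite !mulmx_diag; congr diag_mx; apply/rowP => i; rewrite !mxE.
  have [->|nz] := eqVneq (D 0 i) 0; rewrite ?sqrtC0 ?mulr0 ?mul0r //.
  by rewrite -[X in _ * X = _]sqrtCK expr2 mulKf ?sqrtC_eq0.
have TZ : T *m Z = T.
  rewrite !mulmx_diag; congr diag_mx; apply/rowP => i; rewrite !mxE.
  by have [->|nz] := eqVneq (D 0 i) 0; rewrite ?sqrtC0 ?mulr1 // invr0 mul0r.
have DZ : diag_mx D *m (1%:M - Z) = 0.
  rewrite mul_diag_mx; apply/matrixP => i j; rewrite !mxE.
  have [->|nz] := eqVneq (D 0 i) 0; first by rewrite mul0r.
  by rewrite subrr mulr0.
have T' : T^t* = T.
  rewrite /T tr_diag_mx map_diag_mx; congr diag_mx; apply/rowP => i; rewrite !mxE.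
  by apply/CrealP; rewrite rpredV ger0_real // sqrtC_ge0.
pose V := A *m Q^t* *m T *m Q.
have V' : V^t* = Q^t* *m T *m Q *m A^t*.
  by rewrite !adjmxM T' trmxCK !mulmxA.
have V'A : V^t* *m A = Q^t* *m S *m Q.
  by rewrite V' -mulmxA AE !mulmxA -[X in X *m _ *m Q]mulmxA QQ' mulmx1
    -[X in X *m Q]mulmxA TD.
exists V; split; last exact: V'A.
- have V'V : V^t* *m V = Q^t* *m Z *m Q.
    rewrite /V !mulmxA V'A -!mulmxA; congr (_ *m _); rewrite !mulmxA.
    rewrite -[X in X *m _ *m Q]mulmxA QQ' mulmx1; congr (_ *m _).
    by rewrite -TDT -mulmxA -TD; rewrite !mulmxA.
  rewrite -mulmxA V'V /V !mulmxA -[X in X *m _ *m Q]mulmxA QQ' mulmx1.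
  by rewrite -[X in X *m Q]mulmxA TZ.
- rewrite /V !mulmxA -[X in X *m _ *m Q]mulmxA QQ' mulmx1.
  rewrite -[X in X *m Q]mulmxA TS.
  (* [A] vanishes on the kernel of [A^t* *m A]: the Gram matrix of this product contains the factor
     [diag_mx D *m (1%:M - Z)], which is [0]. *)
  suff /eqP : A *m Q^t* *m (1%:M - Z) = 0.
    rewrite mulmxBr subr_eq0 mulmx1 => /eqP <-.
    by rewrite -mulmxA Q'Q mulmx1.
  apply: gram_eq0; rewrite !adjmxM trmxCK !mulmxA.
  rewrite -[X in X *m _ *m _]mulmxA AE.
  by rewrite -!mulmxA (mulmxA Q) QQ' mul1mx (mulmxA Q) QQ' mul1mx DZ !mulmx0 mxtrace0.
Qed.

End Polar.

(** * Contractions and trace-norm duality *)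

Section TraceNorm.
Variable R : realType.
Local Notation C := R[i].

Lemma ler_Re (x y : C) : x <= y -> complex.Re x <= complex.Re y.
Proof. by rewrite lecE => /andP[]. Qed.

(** Operator norm at most 1. Contractions are the test operators in the dual formula for
    [trace_norm]. *)
Definition contrmx n (X : 'M[C]_n) : Prop := psd (1%:M - X^t* *m X).

Lemma contrmx_mul n (X Y : 'M[C]_n) :
  contrmx X -> contrmx Y -> contrmx (X *m Y).
Proof.
move=> cX cY; rewrite /contrmx.
have -> : 1%:M - (X *m Y)^t* *m (X *m Y) =
    1%:M - Y^t* *m Y + Y^t* *m (1%:M - X^t* *m X) *m Y.
  by rewrite adjmxM mulmxBr mulmx1 mulmxBl !mulmxA addrA subrK.
by apply: psdD; [exact: cY | apply: psd_congr; exact: cX].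
Qed.

Lemma contrmx_opp n (X : 'M[C]_n) : contrmx X -> contrmx (- X).
Proof.
by rewrite /contrmx adjmxN mulNmx mulmxN opprK.
Qed.

Lemma contrmx_unitary n (X : 'M[C]_n) : X \is unitarymx -> contrmx X.
Proof.
by move=> /unitarymxP/mulmx1C e; rewrite /contrmx e subrr; apply: psd0.
Qed.

Lemma contrmx_partial_isometry n (X : 'M[C]_n) :
  X *m X^t* *m X = X -> contrmx X.
Proof.
move=> e; rewrite /contrmx; set P := X^t* *m X.
have PP : P *m P = P by rewrite /P mulmxA -[X in X *m _ = _]mulmxA -mulmxA e.
have P' : P^t* = P by rewrite adjmxM trmxCK.
have -> : 1%:M - P = (1%:M - P)^t* *m (1%:M - P).
  by rewrite adjmxB adjmx1 P' mulmxBr mulmx1 mulmxBl mul1mx PP subrr subr0.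
exact: psd_gram.
Qed.

(** With [P = B^t* *m B], expand the squared Hilbert-Schmidt norm of [X *m B^t* - B^t*].
    Contractivity bounds the term quadratic in [X] by [\tr P], and nonnegativity then bounds the
    cross term. *)
Lemma contrmx_mxtrace_le n (X P : 'M[C]_n) : contrmx X -> psd P ->
  complex.Re (\tr (X *m P)) <= complex.Re (\tr P).
Proof.
move=> cX /psd_factor[B ->].
set D := X *m B^t* - B^t*.
have D0 : 0 <= \tr (D^t* *m D) by apply/psd_mxtrace_ge0/psd_gram.
have := psd_mxtrace_ge0 (psd_congr (B^t*) cX).
rewrite trmxCK mulmxBr mulmxBl mulmx1 mxtraceB subr_ge0 => h.
have e : \tr (D^t* *m D) = \tr (B *m (X^t* *m X) *m B^t*) + \tr (B *m B^t*)
    - (\tr (B *m X *m B^t*) + (\tr (B *m X *m B^t*))^*).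
  rewrite -mxtrace_adj /D adjmxB !adjmxM !trmxCK.
  rewrite mulmxBl !mulmxBr !mxtraceB !mulmxA.
  by rewrite opprB addrACA -opprD [X in _ - X]addrC.
have t : \tr (X *m (B^t* *m B)) = \tr (B *m X *m B^t*).
  by rewrite mulmxA mxtrace_mulC mulmxA.
rewrite t [\tr (B^t* *m B)]mxtrace_mulC.
move: D0; rewrite e subr_ge0 => /ler_Re; move/ler_Re: h.
rewrite !raddfD /=.
have -> z : complex.Re (z^* : C) = complex.Re z by case: z.
lra.
Qed.

Lemma psd_sqrtmx n (A : 'M[C]_n) : psd A -> psd (sqrtmx A).
Proof.
move=> pA; rewrite /sqrtmx invmx_unitary ?spectral_unitarymx //.
apply/psd_congr/psd_diag => i; rewrite !mxE sqrtC_ge0.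
by have [] := psd_spectral pA.
Qed.

Lemma polar_decomposition n (A : 'M[C]_n) : exists V : 'M[C]_n,
  [/\ V *m V^t* *m V = V, V *m sqrtmx (A^t* *m A) = A &
      V^t* *m A = sqrtmx (A^t* *m A)].
Proof.
have [AE Q'Q QQ' D0] := psd_spectral (psd_gram A).
rewrite /sqrtmx invmx_unitary ?spectral_unitarymx //.
exact: (polar_spectral AE Q'Q QQ' D0).
Qed.

Lemma trace_norm_ge0 n (A : 'M[C]_n) : 0 <= trace_norm A.
Proof.
have /psd_sqrtmx/psd_mxtrace_ge0/ler_Re := psd_gram A; exact.
Qed.

(** One half of duality: if [V] is the polar factor of [A], then [X *m V] is still a contraction,
    tested against a psd matrix. *)
Lemma contrmx_trace_norm_le n (X A : 'M[C]_n) : contrmx X ->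
  complex.Re (\tr (X *m A)) <= trace_norm A.
Proof.
move=> cX; have [V [iV e _]] := polar_decomposition A.
rewrite -[X in \tr (_ *m X)]e mulmxA; apply: contrmx_mxtrace_le; last exact/psd_sqrtmx/psd_gram.
exact/contrmx_mul/contrmx_partial_isometry.
Qed.

(** The other half of duality: the adjoint of the polar factor is optimal. *)
Lemma trace_norm_attained n (A : 'M[C]_n) : exists2 X : 'M[C]_n,
  contrmx X & \tr (X *m A) = \tr (sqrtmx (A^t* *m A)).
Proof.
have [V [iV _ e]] := polar_decomposition A; exists (V^t*); last by rewrite e.
apply: contrmx_partial_isometry; rewrite trmxCK.
by rewrite -[RHS](congr1 (fun X => X^t*) iV) !adjmxM trmxCK mulmxA.
Qed.

(** The optimal contraction for [P - Q] is tested on [P], and its negative on [Q]. *)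
Lemma trace_norm_subr_le n (P Q : 'M[C]_n) : psd P -> psd Q ->
  trace_norm (P - Q) <= complex.Re (\tr P) + complex.Re (\tr Q).
Proof.
move=> pP pQ; rewrite /trace_norm; have [X cX <-] := trace_norm_attained (P - Q).
have -> : X *m (P - Q) = X *m P + (- X) *m Q by rewrite mulmxBr mulNmx.
rewrite mxtraceD raddfD; apply: lerD.
  exact: contrmx_mxtrace_le cX pP.
exact: contrmx_mxtrace_le (contrmx_opp cX) pQ.
Qed.

Lemma trace_norm_gt0 n (A : 'M[C]_n) : A != 0 -> 0 < trace_norm A.
Proof.
move=> A0; have pS := psd_sqrtmx (psd_gram A).
rewrite lt_def trace_norm_ge0 andbT; apply: contra A0 => /eqP S0.
have [V [_ <- _]] := polar_decomposition A.
rewrite (psd_mxtrace_eq0 pS) ?mulmx0 //.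
(* [trace_norm] keeps only the real part of the trace; positivity kills the imaginary part. *)
have := psd_mxtrace_ge0 pS; rewrite lecE /= => /andP[/eqP i0 _].
by apply/eqP; rewrite eq_complex /= i0 -/(trace_norm A) S0 !eqxx.
Qed.

End TraceNorm.

(** * Algebra of tensor products and powers *)

Section TensorAlgebra.
Variable K : numClosedFieldType.

Lemma tensmx_suml m n p q (I : finType) (P : pred I) (A : I -> 'M[K]_(m, n))
    (B : 'M[K]_(p, q)) :
  (\sum_(i | P i) A i) ⊗ B = \sum_(i | P i) (A i ⊗ B).
Proof.
apply/matrixP => i j; rewrite !mxE !summxE mulr_suml.
by apply: eq_bigr => k _; rewrite !mxE.
Qed.

Lemma tensmx_sumr m n p q (I : finType) (P : pred I) (A : 'M[K]_(m, n))
    (B : I -> 'M[K]_(p, q)) :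
  A ⊗ (\sum_(i | P i) B i) = \sum_(i | P i) (A ⊗ B i).
Proof.
apply/matrixP => i j; rewrite !mxE !summxE mulr_sumr.
by apply: eq_bigr => k _; rewrite !mxE.
Qed.

Lemma tensmxZl m n p q a (A : 'M[K]_(m, n)) (B : 'M[K]_(p, q)) :
  (a *: A) ⊗ B = a *: (A ⊗ B).
Proof. by apply/matrixP => i j; rewrite !mxE mulrA. Qed.

Lemma tensmxZr m n p q a (A : 'M[K]_(m, n)) (B : 'M[K]_(p, q)) :
  A ⊗ (a *: B) = a *: (A ⊗ B).
Proof. by apply/matrixP => i j; rewrite !mxE mulrCA. Qed.

Lemma tensmxBl m n p q (A A' : 'M[K]_(m, n)) (B : 'M[K]_(p, q)) :
  (A - A') ⊗ B = A ⊗ B - A' ⊗ B.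
Proof. by apply/matrixP => i j; rewrite !mxE mulrBl. Qed.

Lemma adjmx_tens m n p q (A : 'M[K]_(m, n)) (B : 'M[K]_(p, q)) :
  (A ⊗ B)^t* = A^t* ⊗ B^t*.
Proof. by rewrite mxtens.trmx_tens mxtens.map_mxT. Qed.

Lemma mxtrace_tens m n (A : 'M[K]_m) (B : 'M[K]_n) :
  \tr (A ⊗ B) = \tr A * \tr B.
Proof.
rewrite /mxtrace mxtens.mulr_sum.
by apply: eq_bigr => i _; rewrite !mxE.
Qed.

Lemma tensmx1 m n : (1%:M : 'M[K]_m) ⊗ (1%:M : 'M[K]_n) = 1%:M.
Proof.
apply/matrixP => i j.
case: (mxtens.mxtens_indexP i) => i1 i2; case: (mxtens.mxtens_indexP j) => j1 j2.
rewrite mxtens.tensmxE !mxE (can_eq (@mxtens.mxtens_indexK _ _)).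
by rewrite -natrM mulnb.
Qed.

Section Cast.
Variables (p q : nat) (e : p = q).
Implicit Types A B : 'M[K]_p.

Lemma castmx_mulmx A B : castmx (e, e) (A *m B) = castmx (e, e) A *m castmx (e, e) B.
Proof. by case: q / e. Qed.

Lemma mxtrace_castmx A : \tr (castmx (e, e) A) = \tr A.
Proof. by case: q / e. Qed.

Lemma adjmx_castmx A : (castmx (e, e) A)^t* = castmx (e, e) (A^t*).
Proof. by case: q / e. Qed.

Lemma castmx_scalar a : castmx (e, e) a%:M = a%:M :> 'M[K]_q.
Proof. by case: q / e. Qed.

Lemma castmxZ a A : castmx (e, e) (a *: A) = a *: castmx (e, e) A.
Proof. by case: q / e. Qed.

Lemma castmx_sum (I : finType) (P : pred I) (A : I -> 'M[K]_p) :
  castmx (e, e) (\sum_(i | P i) A i) = \sum_(i | P i) castmx (e, e) (A i).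
Proof. by case: q / e. Qed.

End Cast.

(** [d ^ 1] and [d * d ^ 0] are not convertible, so a uniform recursion on tensor powers needs a
    cast. *)
Definition castS d n (A : 'M[K]_(d * d ^ n)) : 'M[K]_(d ^ n.+1) :=
  castmx (esym (expnS d n), esym (expnS d n)) A.

Lemma ntensmxS d n (A : 'M[K]_d) : A ^⊗ n.+1 = castS (A ⊗ A ^⊗ n).
Proof.
case: n => [|n]; last by rewrite /castS castmx_id.
rewrite /castS mxtens.ntensmx0 mxtens.tens_mx_scalar scale1r castmx_comp.
by rewrite castmx_id.
Qed.

Lemma ntensmx_mul d n (A B : 'M[K]_d) : (A *m B) ^⊗ n = A ^⊗ n *m B ^⊗ n.
Proof.
elim: n => [|n IH]; first by rewrite mulmx1.
by rewrite !ntensmxS IH -mxtens.tensmx_mul /castS castmx_mulmx.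
Qed.

Lemma adjmx_ntens d n (A : 'M[K]_d) : (A ^⊗ n)^t* = (A^t*) ^⊗ n.
Proof.
elim: n => [|n IH]; first by rewrite mxtens.ntensmx0 adjmx1.
by rewrite !ntensmxS -IH /castS adjmx_castmx adjmx_tens.
Qed.

Lemma mxtrace_ntens d n (A : 'M[K]_d) : \tr (A ^⊗ n) = \tr A ^+ n.
Proof.
elim: n => [|n IH]; first by rewrite mxtens.ntensmx0 mxtrace1.
by rewrite !ntensmxS /castS mxtrace_castmx mxtrace_tens IH exprS.
Qed.

Lemma ntensmx_1 d n : (1%:M : 'M[K]_d) ^⊗ n = 1%:M.
Proof.
by elim: n => [|n IH]; rewrite // ntensmxS /castS IH tensmx1 castmx_scalar.
Qed.

Lemma ntensmx_unitary d n (A : 'M[K]_d) :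
  A \is unitarymx -> A ^⊗ n \is unitarymx.
Proof.
by move=> /unitarymxP e; apply/unitarymxP; rewrite adjmx_ntens -ntensmx_mul e ntensmx_1.
Qed.

Lemma ntensmx_conj d n (V A : 'M[K]_d) :
  (V *m A *m V^t*) ^⊗ n = V ^⊗ n *m A ^⊗ n *m (V^t*) ^⊗ n.
Proof. by rewrite !ntensmx_mul. Qed.

End TensorAlgebra.

(** * Positivity, states and contractions under tensor products *)

Section TensorPositive.
Variable R : realType.
Local Notation C := R[i].

Lemma psd_castmx p q (e : p = q) (A : 'M[C]_p) : psd A -> psd (castmx (e, e) A).
Proof. by case: q / e. Qed.

Lemma psd_tens m n (A : 'M[C]_m) (B : 'M[C]_n) : psd A -> psd B -> psd (A ⊗ B).
Proof.
move=> /psd_factor[A' ->] /psd_factor[B' ->].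
by rewrite -mxtens.tensmx_mul -adjmx_tens; apply: psd_gram.
Qed.

Lemma psd_1 n : psd (1%:M : 'M[C]_n).
Proof. by rewrite -[1%:M]mulmx1 -{1}[1%:M]adjmx1; apply: psd_gram. Qed.

Lemma psd_ntens d n (A : 'M[C]_d) : psd A -> psd (A ^⊗ n).
Proof.
move=> pA; elim: n => [|n IH]; first exact: psd_1.
by rewrite ntensmxS; apply/psd_castmx/psd_tens.
Qed.

Lemma is_state_ntens d n (A : 'M[C]_d) : is_state A -> is_state (A ^⊗ n).
Proof.
by move=> [pA tA]; split; [exact: psd_ntens | rewrite mxtrace_ntens tA expr1n].
Qed.

Lemma is_state_conj d (V A : 'M[C]_d) : V \is unitarymx ->
  is_state A -> is_state (V *m A *m V^t*).
Proof.
move=> /unitarymxP/mulmx1C e [pA tA]; split.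
  by rewrite -[X in X *m _ *m _]trmxCK; apply: psd_congr.
by rewrite mxtrace_mulC mulmxA e mul1mx.
Qed.

Lemma contrmx_tens1 (m n : nat) (X : 'M[C]_m) :
  contrmx X -> contrmx (X ⊗ (1%:M : 'M[C]_n)).
Proof.
move=> cX; rewrite /contrmx adjmx_tens mxtens.tensmx_mul adjmx1 mulmx1.
by rewrite -tensmx1 -tensmxBl; apply: psd_tens; [exact: cX|exact: psd_1].
Qed.

Lemma contrmx_castmx p q (e : p = q) (X : 'M[C]_p) :
  contrmx X -> contrmx (castmx (e, e) X).
Proof. by case: q / e. Qed.

End TensorPositive.

(** * Classical postprocessing of independent measurements *)

Section Postprocessing.
Variables (R : realType) (Omega : finType) (d : nat).
Local Notation C := R[i].
Variable F : Omega -> 'M[C]_d.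

(** The sum over words [s] of length [n] of [f s] times the tensor product of the [F w] along [s].
    For a POVM [F] and [f] valued in [[0, 1]], this is the effect of measuring every copy and
    accepting the record [s] with probability [f s]. *)
Fixpoint postproc n (f : seq Omega -> C) : 'M[C]_(d ^ n) :=
  if n is n'.+1 then castS (\sum_w F w ⊗ postproc n' (fun s => f (w :: s)))
  else (f [::])%:M.

Lemma postprocS n f :
  postproc n.+1 f = castS (\sum_w F w ⊗ postproc n (fun s => f (w :: s))).
Proof. by []. Qed.

Lemma psd_postproc n f : (forall w, psd (F w)) -> (forall s, 0 <= f s) ->
  psd (postproc n f).
Proof.
move=> pF; elim: n f => [|n IH] f f0.
  by rewrite /= -[_%:M]scalemx1; apply/psdZ/psd_1/f0.
rewrite postprocS; apply/psd_castmx/psd_sum => w _.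
by apply: psd_tens; [exact: pF | apply: IH].
Qed.

Lemma postproc_sum n (I : finType) (f : I -> seq Omega -> C) :
  postproc n (fun s => \sum_i f i s) = \sum_i postproc n (f i).
Proof.
elim: n f => [|n IH] f /=; first exact: raddf_sum.
rewrite /castS -castmx_sum; congr castmx; rewrite exchange_big /=.
by apply: eq_bigr => w _; rewrite IH tensmx_sumr.
Qed.

Lemma eq_postproc n f g : f =1 g -> postproc n f = postproc n g.
Proof. by move=> /funext ->. Qed.

Lemma postprocB n f g :
  postproc n (fun s => f s - g s) = postproc n f - postproc n g.
Proof.
elim: n f g => [|n IH] f g /=; first exact: raddfB.
apply/eqP; rewrite eq_sym subr_eq /castS; apply/eqP.
have castD A B : castmx (esym (expnS d n), esym (expnS d n)) (A + B) =
   castmx (esym (expnS d n), esym (expnS d n)) A +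
   castmx (esym (expnS d n), esym (expnS d n)) B :> 'M[C]_(d ^ n.+1).
  by case: _ / (esym _).
rewrite -castD -big_split /=; congr castmx; apply: eq_bigr => w _.
by rewrite IH; apply/matrixP => i j; rewrite !mxE -mulrDr subrK.
Qed.

(** A weight that is a product over letters factorizes over the copies; this is what turns the
    Chernoff bound into an [n]-th power. *)
Lemma postproc_prod n (w : Omega -> C) :
  postproc n (fun s => \prod_(x <- s) w x) = (\sum_x w x *: F x) ^⊗ n.
Proof.
(* The scalar [a] absorbs the weights of the letters already read. *)
suff h a : postproc n (fun s => a * \prod_(x <- s) w x) =
    a *: (\sum_x w x *: F x) ^⊗ n.
  by rewrite -[RHS]scale1r -h; apply: eq_postproc => s; rewrite mul1r.
elim: n a => [|n IH] a /=.
  by rewrite big_nil mulr1 mxtens.ntensmx0 scalemx1.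
rewrite ntensmxS /castS -castmxZ; congr castmx.
rewrite tensmx_suml scaler_sumr; apply: eq_bigr => x _.
rewrite tensmxZl scalerA -tensmxZr -IH; congr (_ ⊗ _).
by apply: eq_postproc => s; rewrite big_cons mulrA.
Qed.

(** Conjugation permutes the one-copy effects, so each tensor factor is reindexed by [pi]. *)
Lemma postproc_conj n (V : 'M[C]_d) (pi : Omega -> Omega) f : bijective pi ->
  (forall w, V *m F w *m V^t* = F (pi w)) ->
  V ^⊗ n *m postproc n (fun s => f (map pi s)) *m (V^t*) ^⊗ n = postproc n f.
Proof.
move=> bpi VF; elim: n f => [|n IH] f.
  by rewrite /= !mxtens.ntensmx0 mul1mx mulmx1.
rewrite !postprocS !ntensmxS /castS -!castmx_mulmx; congr castmx.
rewrite mulmx_sumr mulmx_suml [RHS](reindex pi) /=; last exact: onW_bij.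
apply: eq_bigr => w _; rewrite !mxtens.tensmx_mul VF; congr (_ ⊗ _).
exact: (IH (fun s => f (pi w :: s))).
Qed.

End Postprocessing.

(** * Measure-and-prepare channels *)

Section MeasurePrepare.
Variables (R : realType) (I : finType) (p q : nat).
Local Notation C := R[i].
Variables (M : I -> 'M[C]_p) (S : I -> 'M[C]_q).

Definition measure_prepare (L : 'M[C]_p) : 'M[C]_q :=
  \sum_i \tr (M i *m L) *: S i.

Fact measure_prepare_is_linear : linear measure_prepare.
Proof.
move=> a L L'; rewrite /measure_prepare scaler_sumr -big_split /=.
apply: eq_bigr => i _.
by rewrite mulmxDr -scalemxAr mxtraceD mxtraceZ scalerDl scalerA.
Qed.

HB.instance Definition _ := GRing.isLinear.Build C 'M[C]_p 'M[C]_q *:%R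
  measure_prepare measure_prepare_is_linear.

End MeasurePrepare.

Section MeasurePrepareCPTP.
Variable R : realType.
Local Notation C := R[i].

Lemma sum_mxtens (V : nmodType) m n (F : 'I_(m * n) -> V) :
  \sum_x F x = \sum_i \sum_j F (mxtens.mxtens_index (i, j)).
Proof.
rewrite pair_big (reindex (@mxtens.mxtens_index m n)) /=; last first.
  apply: onW_bij; exists (@mxtens.mxtens_unindex m n).
    exact: mxtens.mxtens_indexK.
  exact: mxtens.mxtens_unindexK.
by apply: eq_bigr => -[].
Qed.

(** This is the partial trace of [X] against [M] on the second factor. With [M = B^t* *m B], each
    row of [B] contributes one compression of [X]: [W r] is the identity tensored with the adjoint
    of row [r]. *)
Lemma psd_block_mxtrace k p (M : 'M[C]_p) (X : 'M[C]_(k * p)) :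
  psd M -> psd X ->
  psd (\matrix_(i, j) \tr (M *m \matrix_(a, b)
         X (mxtens.mxtens_index (i, a)) (mxtens.mxtens_index (j, b)))).
Proof.
move=> /psd_factor[B ->] pX.
pose W r : 'M[C]_(k * p, k) := \matrix_(x, l)
  ((B r (mxtens.mxtens_unindex x).2)^* *+ ((mxtens.mxtens_unindex x).1 == l)).
suff -> : \matrix_(i, j) \tr (B^t* *m B *m \matrix_(a, b)
   X (mxtens.mxtens_index (i, a)) (mxtens.mxtens_index (j, b))) =
   \sum_r (W r)^t* *m X *m W r.
  by apply: psd_sum => r _; apply: psd_congr.
have WE r l b j : W r (mxtens.mxtens_index (l, b)) j = (B r b)^* *+ (l == j).
  by rewrite mxE mxtens.mxtens_indexK.
apply/matrixP => i j; rewrite mxE summxE -mulmxA mxtrace_mulC.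
apply: eq_bigr => r _; rewrite [LHS]mxE [RHS]mxE sum_mxtens (bigD1 j) //=.
rewrite [X in _ = _ + X]big1 ?addr0 => [|l /negPf lj]; last first.
  by apply: big1 => b _; rewrite WE lj mulr0n mulr0.
apply: eq_bigr => b _; rewrite WE eqxx mulr1n; congr (_ * _); last by rewrite !mxE.
rewrite [LHS]mxE [RHS]mxE sum_mxtens (bigD1 i) //=.
rewrite [X in _ = _ + X]big1 ?addr0 => [|l /negPf li]; last first.
  by apply: big1 => a _; rewrite 2!mxE WE li mulr0n conjC0 mul0r.
apply: eq_bigr => a _; rewrite mxE; congr (_ * _).
by rewrite 2!mxE WE eqxx mulr1n conjCK.
Qed.

(** The ampliation sends [X] to a sum of products [Y i ⊗ S i], where [Y i] is the partial trace of
    [X] against [M i]; positivity is then termwise. *)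
Lemma measure_prepare_cptp (I : finType) p q (M : I -> 'M[C]_p)
    (S : I -> 'M[C]_q) :
  (forall i, psd (M i)) -> \sum_i M i = 1%:M -> (forall i, is_state (S i)) ->
  cptp (measure_prepare M S).
Proof.
move=> pM M1 stS; split => [k X pX|L].
- pose Y i := \matrix_(k, l) \tr (M i *m \matrix_(a, b)
    X (mxtens.mxtens_index (k, a)) (mxtens.mxtens_index (l, b))).
  have -> : ampliation (measure_prepare M S) X = \sum_i (Y i ⊗ S i).
    under [RHS]eq_bigr => i _ do rewrite (matrix_sum_delta (Y i)) tensmx_suml.
    rewrite exchange_big; apply: eq_bigr => k' _ /=.
    under [RHS]eq_bigr => i _ do rewrite tensmx_suml.
    rewrite exchange_big; apply: eq_bigr => l _ /=.
    rewrite tensmx_sumr; apply: eq_bigr => i _.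
    by rewrite tensmxZr tensmxZl mxE.
  apply: psd_sum => i _; apply: psd_tens; last by have [] := stS i.
  exact: psd_block_mxtrace.
- rewrite /measure_prepare raddf_sum -[in RHS](mul1mx L) -M1 mulmx_suml raddf_sum.
  by apply: eq_bigr => i _ /=; rewrite mxtraceZ (proj2 (stS i)) mulr1.
Qed.

End MeasurePrepareCPTP.

(** * Action of a projective representation on operators *)

Section Representation.
Variables (R : realType) (G : finGroupType) (d : nat) (U : G -> 'M[R[i]]_d).
Local Notation C := R[i].
Hypothesis pU : projective_unitary_rep U.

Definition conj_rep (A : 'M[C]_d) g := U g *m A *m (U g)^t*.

(** The phase meets its conjugate and cancels, so conjugation is a genuine group action. *)
Lemma conj_repM A g h : U h *m conj_rep A g *m (U h)^t* = conj_rep A (h * g)%g.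
Proof.
have [_ [om [om1 omE]]] := pU; rewrite /conj_rep !mulmxA omE.
rewrite -!mulmxA -adjmxM omE adjmxZ -!scalemxAl -!scalemxAr scalerA.
by rewrite -normCK om1 expr1n scale1r.
Qed.

Lemma conj_rep_adjK A g : (U g)^t* *m conj_rep A g *m U g = A.
Proof.
have /unitarymxP/mulmx1C e := (proj1 pU) g.
by rewrite /conj_rep !mulmxA e mul1mx -mulmxA e mulmx1.
Qed.

(** [U 1] need not be the identity matrix, but conjugation by it is idempotent and injective. *)
Lemma conj_rep1 A : conj_rep A 1%g = A.
Proof.
have h := conj_repM A 1%g 1%g; rewrite mulg1 in h.
by rewrite -[LHS](conj_rep_adjK _ 1%g) /conj_rep -/(conj_rep A 1%g) h conj_rep_adjK.
Qed.

Lemma sym_subgroup1 A : 1%g \in sym_subgroup U A.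
Proof. by rewrite inE -/(conj_rep A 1%g) conj_rep1. Qed.

Lemma sym_subgroupP A g : (g \in sym_subgroup U A) = (conj_rep A g == A).
Proof. by rewrite inE. Qed.

Lemma is_state_conj_rep A g : is_state A -> is_state (conj_rep A g).
Proof. by apply: is_state_conj; exact: (proj1 pU). Qed.

(** [A] and its translate have equal purity, so the squared Hilbert-Schmidt norm of their difference
    is twice the gap. *)
Lemma conj_rep_overlap_lt A g : is_state A -> g \notin sym_subgroup U A ->
  \tr (conj_rep A g *m A) < \tr (A *m A).
Proof.
move=> stA; rewrite sym_subgroupP => gA.
have [pAg _] := is_state_conj_rep g stA; have [pA _] := stA.
set B := conj_rep A g in gA pAg *.
have trBB : \tr (B *m B) = \tr (A *m A).
  have /unitarymxP/mulmx1C e := (proj1 pU) g.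
  rewrite /B /conj_rep -!mulmxA (mulmxA ((U g)^t*)) e mul1mx.
  by rewrite mxtrace_mulC -!mulmxA e mulmx1.
have : 0 < \tr ((B - A)^t* *m (B - A)).
  rewrite lt_def psd_mxtrace_ge0 ?andbT; last exact: psd_gram.
  by apply: contra gA => /eqP/gram_eq0/eqP; rewrite subr_eq0.
rewrite adjmxB !psd_adj // mulmxBl !mulmxBr !mxtraceB trBB [\tr (A *m B)]mxtrace_mulC.
by rewrite opprB -mulr2n pmulrn_lgt0 // subr_gt0.
Qed.

End Representation.

(** * Plurality voting and exponential tilting *)

Section Vote.
Variables (K : numClosedFieldType) (G : finGroupType).
Implicit Types (s : seq (option G)) (g h : G).

(** The letter [None] is the inconclusive outcome and votes for nobody. *)
Definition votes s g := count_mem (Some g) s.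
Definition winners s := [set g | [forall h, votes s h <= votes s g]%N].
Definition elect g s : K := if g \in winners s then #|winners s|%:R^-1 else 0.

Lemma winners_gt0 s : (0 < #|winners s|)%N.
Proof.
apply/card_gt0P; case: (@arg_maxnP _ 1%g xpredT (votes s)) => // g _ gmax.
by exists g; rewrite inE; apply/forallP => h; apply: gmax.
Qed.

Lemma elect_ge0 g s : 0 <= elect g s.
Proof. by rewrite /elect; case: ifP; rewrite ?invr_ge0. Qed.

Lemma elect_sum s : \sum_g elect g s = 1.
Proof.
rewrite /elect -big_mkcond sumr_const -[LHS]mulr_natl mulfV //.
by rewrite pnatr_eq0 -lt0n winners_gt0.
Qed.

Definition relabel h : option G -> option G := omap (mulg h).

Lemma relabel_bij h : bijective (relabel h).
Proof.
by exists (relabel h^-1) => -[x|] //=; rewrite /relabel /= (mulKg, mulKVg).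
Qed.

Lemma votes_relabel h s g : votes (map (relabel h) s) (h * g)%g = votes s g.
Proof.
rewrite /votes count_map; apply: eq_count => -[x|] //=.
by rewrite /relabel /= !(inj_eq (@Some_inj _)) (inj_eq (mulgI h)).
Qed.

Lemma winners_relabel h s g :
  ((h * g)%g \in winners (map (relabel h) s)) = (g \in winners s).
Proof.
rewrite !inE; apply/forallP/forallP => m k.
  by have := m (h * k)%g; rewrite !votes_relabel.
by have := m (h^-1 * k)%g; rewrite -{2}(mulKVg h k) !votes_relabel.
Qed.

(** Left multiplication by [h] maps winners bijectively to winners, and uniform tie-breaking depends
    only on their number. *)
Lemma elect_relabel h g s : elect (h * g)%g (map (relabel h) s) = elect g s.
Proof.
rewrite /elect winners_relabel; suff -> : #|winners (map (relabel h) s)| = #|winners s| by [].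
rewrite -(card_imset (mem (winners s)) (mulgI h)); apply: eq_card => k.
apply/idP/imsetP => [kw|[x xw ->]]; last by rewrite winners_relabel.
by exists (h^-1 * k)%g; rewrite ?mulKVg // -(winners_relabel h) mulKVg.
Qed.

(** Chernoff weights: for [g] other than [1], they multiply along a word to [t] raised to the margin
    of [1] over [g]. *)
Definition tilt (t : K) g (x : option G) : K :=
  if x == Some 1%g then t else if x == Some g then t^-1 else 1.

Lemma tilt_prod t g s : t != 0 -> g != 1%g ->
  \prod_(x <- s) tilt t g x = t ^+ votes s 1%g / t ^+ votes s g.
Proof.
move=> t0 g1; elim: s => [|x s IH]; first by rewrite big_nil divr1.
rewrite big_cons IH /tilt /votes /=.
have [->|x1] := eqVneq x (Some 1%g).
  by rewrite (inj_eq (@Some_inj _)) eq_sym (negPf g1) add0n add1n exprS mulrA.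
rewrite add0n; have [_|xg] := eqVneq x (Some g).
  by rewrite add1n exprS invfM mulrCA.
by rewrite mul1r.
Qed.

(* Chernoff: [g] can only win against [1] if its tilted likelihood is >= 1. *)
Lemma elect_le_tilt t g s : 0 < t -> t < 1 -> g != 1%g ->
  elect g s <= \prod_(x <- s) tilt t g x.
Proof.
move=> t0 t1 g1; rewrite tilt_prod ?gt_eqF //.
rewrite /elect; case: ifP => [|_]; last by rewrite divr_ge0 ?exprn_ge0 // ltW.
rewrite inE => /forallP/(_ 1%g) h.
apply: (@le_trans _ _ 1).
  by rewrite invf_le1 ?ltr0n ?winners_gt0 // ler1n winners_gt0.
by rewrite ler_pdivlMr ?exprn_gt0 // mul1r ler_wiXn2l // ltW.
Qed.

(** If [1] and [g] have probabilities [a] and [b], this expression is the excess over 1 of the mean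
    of [tilt]. It factors as [(t - 1) * (a * t - b) / t], negative for [b / a < t < 1]. *)
Lemma tilt_rate (a b : K) : 0 <= b -> b < a ->
  exists2 t : K, 0 < t < 1 & (t - 1) * a + (t^-1 - 1) * b < 0.
Proof.
move=> b0 ba; have a0 : 0 < a by exact: le_lt_trans b0 ba.
have an0 : a != 0 by rewrite gt_eqF.
(* The midpoint of [b / a] and [1]. *)
pose t := (a + b) / (a + a).
have aa0 : 0 < a + a by rewrite addr_gt0.
have t0 : 0 < t by rewrite divr_gt0 // ltr_wpDr.
have t1 : t < 1 by rewrite ltr_pdivrMr // mul1r ltrD2l.
exists t; first by rewrite t0.
have tn0 : t != 0 by rewrite gt_eqF.
have -> : (t - 1) * a + (t^-1 - 1) * b = (t - 1) * ((a * t - b) / t) by field.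
rewrite nmulr_rlt0 ?subr_lt0 // divr_gt0 // subr_gt0 /t.
rewrite mulrA ltr_pdivlMr // [a * _]mulrC mulrDl mulrDr.
by rewrite ltrD2r mulrC ltr_pM2l // .
Qed.

End Vote.

(** * The orbit measurement and its exponential error bound *)

Lemma mxtrace_affine (K : comNzRingType) n (x y : K) (A B D : 'M[K]_n) :
  \tr ((1%:M + (x *: A + y *: B)) *m D) =
  \tr D + (x * \tr (A *m D) + y * \tr (B *m D)).
Proof. by rewrite !mulmxDl mul1mx -!scalemxAl !mxtraceD !mxtraceZ. Qed.

Section OrbitMeasurement.
Variables (R : realType) (G : finGroupType) (d : nat) (U : G -> 'M[R[i]]_d).
Variable rho : 'M[R[i]]_d.
Local Notation C := R[i].
Hypotheses (pU : projective_unitary_rep U) (st_rho : is_state rho).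

(** The weight [#|G|%:R^-1] leaves room for all translates: [None] receives the average of their
    complements, each psd because a state is at most the identity. *)
Definition orbit_povm (x : option G) : 'M[C]_d :=
  #|G|%:R^-1 *: (if x is Some g then conj_rep U rho g
                 else \sum_g (1%:M - conj_rep U rho g)).

Lemma psd_orbit_povm x : psd (orbit_povm x).
Proof.
apply: psdZ; first by rewrite invr_ge0.
case: x => [g|]; first by have [] := is_state_conj_rep pU g st_rho.
apply: psd_sum => g _; have [p t] := is_state_conj_rep pU g st_rho.
by have := psd_mxtrace_subl p; rewrite t.
Qed.

Lemma sum_option (V : nmodType) (f : option G -> V) :
  \sum_x f x = f None + \sum_g f (Some g).
Proof.
rewrite (bigD1 None) //=; congr (_ + _).
rewrite (reindex_omap Some id) => [|[]] //=.
by apply: eq_bigl => g; rewrite eqxx.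
Qed.

Lemma orbit_povm_sum : \sum_x orbit_povm x = 1%:M.
Proof.
rewrite sum_option -scaler_sumr -scalerDr -big_split /=.
under eq_bigr do rewrite subrK.
rewrite sumr_const -[X in _ *: X]scaler_nat scalerA mulVf ?scale1r //.
by rewrite pnatr_eq0 -lt0n; apply/card_gt0P; exists 1%g.
Qed.

Lemma orbit_povm_conj h x :
  U h *m orbit_povm x *m (U h)^t* = orbit_povm (relabel h x).
Proof.
rewrite /orbit_povm -scalemxAr -scalemxAl; congr (_ *: _).
case: x => [g|] /=; first exact: conj_repM.
have /unitarymxP e := (proj1 pU) h.
rewrite mulmx_sumr mulmx_suml [RHS](reindex_inj (mulgI h)) /=.
by apply: eq_bigr => g _; rewrite mulmxBr mulmxBl mulmx1 e conj_repM.
Qed.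

Definition vote_effect n g := postproc orbit_povm n (elect C g).

Lemma psd_vote_effect n g : psd (vote_effect n g).
Proof. by apply: psd_postproc; [exact: psd_orbit_povm|exact: elect_ge0]. Qed.

Lemma postproc_orbit1 n : postproc orbit_povm n (fun=> 1) = 1%:M.
Proof.
rewrite -[RHS](@ntensmx_1 _ d) -orbit_povm_sum.
under [X in X ^⊗ _]eq_bigr do rewrite -[orbit_povm _]scale1r.
by rewrite -postproc_prod; apply: eq_postproc => s; rewrite big1.
Qed.

Lemma vote_effect_sum n : \sum_g vote_effect n g = 1%:M.
Proof.
rewrite -postproc_sum -(postproc_orbit1 n).
by apply: eq_postproc => s; rewrite elect_sum.
Qed.

Lemma vote_effect_conj n h g :
  (U h) ^⊗ n *m vote_effect n g *m ((U h)^t*) ^⊗ n = vote_effect n (h * g)%g.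
Proof.
rewrite -[RHS](postproc_conj n _ (relabel_bij h) (orbit_povm_conj h)).
by congr (_ *m _ *m _); apply: eq_postproc => s; rewrite elect_relabel.
Qed.

(** Chernoff bound for operators: [elect] lies below the tilted product, so the vote effect lies
    below [B ^⊗ n], whose mean in [rho ^⊗ n] is the [n]-th power of the one-copy mean. *)
Lemma vote_effect_error g : g \notin sym_subgroup U rho ->
  exists2 c : R, 0 <= c < 1 & forall n,
    complex.Re (\tr (vote_effect n g *m rho ^⊗ n)) <= c ^+ n.
Proof.
move=> gS; have [p_rho t_rho] := st_rho.
have g1 : g != 1%g by apply: contraNneq gS => ->; exact: sym_subgroup1.
(* [a] and [b] are the probabilities that one copy votes for [1] and for [g]. *)
pose a := \tr (orbit_povm (Some 1%g) *m rho).
pose b := \tr (orbit_povm (Some g) *m rho).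
have b0 : 0 <= b := psd_mxtrace_mulmx_ge0 (psd_orbit_povm _) p_rho.
have ba : b < a.
  rewrite /a /b /orbit_povm -!scalemxAl !mxtraceZ ltr_pM2l.
    by rewrite conj_rep1 // conj_rep_overlap_lt.
  by rewrite invr_gt0 ltr0n; apply/card_gt0P; exists 1%g.
have [t /andP[t0 t1] rate] := tilt_rate b0 ba.
pose B := \sum_x tilt t g x *: orbit_povm x.
have tilt0 x : 0 <= tilt t g x.
  by rewrite /tilt; do 2?case: ifP => _; rewrite ?invr_ge0 ?ltW.
have pB : psd B by apply: psd_sum => x _; exact: psdZ (psd_orbit_povm x).
pose c := \tr (B *m rho).
have c0 : 0 <= c := psd_mxtrace_mulmx_ge0 pB p_rho.
have cE : c = 1 + ((t - 1) * a + (t^-1 - 1) * b).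
  (* The weights are 1 on all other letters, so completeness of the POVM leaves the identity plus
     two corrections. *)
  rewrite /c; have -> : B = 1%:M + ((t - 1) *: orbit_povm (Some 1%g)
                        + (t^-1 - 1) *: orbit_povm (Some g)).
    rewrite -orbit_povm_sum /B (bigD1 (Some 1%g)) // [in RHS](bigD1 (Some 1%g)) //=.
    have gn : Some g != Some 1%g :> option G by rewrite (inj_eq (@Some_inj _)).
    rewrite (bigD1 (Some g)) // [in RHS](bigD1 (Some g)) //=.
    rewrite /tilt eqxx (negPf gn) eqxx !scalerBl !scale1r.
    rewrite (eq_bigr orbit_povm) => [|x /andP[/negPf x1 /negPf xg]]; last first.
      by rewrite x1 xg scale1r.
    move: (orbit_povm (Some 1%g)) (orbit_povm (Some g)) (\sum_(_ | _) _) => X Y Z.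
    by rewrite addrACA subrKC [Y + Z + _]addrC [X in _ = _ + X]addrA subrK.
  by rewrite mxtrace_affine t_rho.
have c1 : c < 1 by rewrite cE gtrDl.
have cR : c = (complex.Re c)%:C by rewrite RRe_real // ger0_real.
exists (complex.Re c) => [|n].
  by rewrite -lecR -ltcR -cR c0.
suff : \tr (vote_effect n g *m rho ^⊗ n) <= c ^+ n.
  by move/ler_Re; rewrite {1}cR -rmorphXn.
have -> : c ^+ n = \tr (postproc orbit_povm n (fun s => \prod_(x <- s) tilt t g x)
    *m rho ^⊗ n).
  by rewrite postproc_prod -ntensmx_mul mxtrace_ntens.
rewrite -subr_ge0 -mxtraceB -mulmxBl -postprocB.
apply: psd_mxtrace_mulmx_ge0; last exact: psd_ntens.
apply: psd_postproc => [|s]; first exact: psd_orbit_povm.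
by rewrite subr_ge0 elect_le_tilt.
Qed.

End OrbitMeasurement.

(** * Achievability of every rate *)

Section Achievability.
Variables (R : realType) (G : finGroupType) (d d' : nat).
Local Notation C := R[i].
Variables (U : G -> 'M[C]_d) (U' : G -> 'M[C]_d').
Variables (rho : 'M[C]_d) (sigma : 'M[C]_d').
Hypotheses (pU : projective_unitary_rep U) (pU' : projective_unitary_rep U').
Hypotheses (st_rho : is_state rho) (st_sigma : is_state sigma).

(** [m] is independent of [n]: once an element is elected, any number of copies can be prepared. *)
Definition vote_channel n m : {linear 'M[C]_(d ^ n) -> 'M[C]_(d' ^ m)} :=
  measure_prepare (vote_effect U rho n) (fun g => (conj_rep U' sigma g) ^⊗ m).

Lemma vote_channel_cptp n m : cptp (vote_channel n m).
Proof.
apply: measure_prepare_cptp => [g||g].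
- exact: psd_vote_effect.
- exact: vote_effect_sum.
- exact/is_state_ntens/is_state_conj_rep.
Qed.

(** Reindexing by [h] matches the prepared states; equivariance of the effects and cyclicity of the
    trace match the probabilities. *)
Lemma vote_channel_covariant n m : covariant U U' (vote_channel n m).
Proof.
move=> h L; rewrite /= /measure_prepare (reindex_inj (mulgI h)) /=.
rewrite mulmx_sumr mulmx_suml; apply: eq_bigr => g _.
rewrite -scalemxAr -scalemxAl -ntensmx_conj conj_repM //; congr (_ *: _).
have /unitarymxP/mulmx1C e : (U h) ^⊗ n \is unitarymx.
  by apply: ntensmx_unitary; exact: (proj1 pU).
rewrite -(vote_effect_conj rho pU) -adjmx_ntens -!mulmxA.
rewrite (mulmxA ((U h ^⊗ n)^t*)) e mul1mx mxtrace_mulC -!mulmxA e mulmx1.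
by [].
Qed.

(** Elections inside [sym_subgroup U rho] output [sigma ^⊗ m] exactly. If the others have
    probability [q], the deviation is a difference of two psd matrices of trace [q], whatever [m]
    is. *)
Lemma vote_channel_error n m :
  sym_subgroup U rho \subset sym_subgroup U' sigma ->
  trace_dist (vote_channel n m (rho ^⊗ n)) (sigma ^⊗ m) <=
  \sum_(g | g \notin sym_subgroup U rho)
     complex.Re (\tr (vote_effect U rho n g *m rho ^⊗ n)).
Proof.
move=> sub; set p := fun g => \tr (vote_effect U rho n g *m rho ^⊗ n).
have p0 g : 0 <= p g.
  apply: psd_mxtrace_mulmx_ge0; first exact: psd_vote_effect.
  by apply: psd_ntens; case: st_rho.
have p1 : \sum_g p g = 1.
  rewrite /p -raddf_sum -mulmx_suml vote_effect_sum // mul1mx.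
  by case: (is_state_ntens n st_rho).
pose q := \sum_(g | g \notin sym_subgroup U rho) p g.
pose P := \sum_(g | g \notin sym_subgroup U rho) p g *: (conj_rep U' sigma g) ^⊗ m.
have -> : vote_channel n m (rho ^⊗ n) = sigma ^⊗ m - q *: sigma ^⊗ m + P.
  rewrite /= /measure_prepare (bigID (mem (sym_subgroup U rho))) /=; congr (_ + _).
  rewrite (eq_bigr (fun g => p g *: sigma ^⊗ m)) => [|g gS]; last first.
    by move: (fintype.subsetP sub _ gS); rewrite sym_subgroupP => /eqP ->.
  rewrite -scaler_suml -[X in X - _]scale1r -scalerBl; congr (_ *: _).
  apply/eqP; rewrite eq_sym subr_eq -p1.
  by rewrite [X in X == _](bigID (mem (sym_subgroup U rho))).
have pP : psd P.
  apply: psd_sum => g _; apply: psdZ; first exact: p0.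
  by have [] := is_state_ntens m (is_state_conj_rep pU' g st_sigma).
have [psm tsm] := is_state_ntens m st_sigma.
have q0 : 0 <= q by apply: sumr_ge0.
have trP : \tr P = q.
  rewrite /P raddf_sum; apply: eq_bigr => g _ /=; rewrite mxtraceZ.
  by rewrite (proj2 (is_state_ntens m (is_state_conj_rep pU' g st_sigma))) mulr1.
have -> : \sum_(g | g \notin sym_subgroup U rho) complex.Re (p g) = complex.Re q.
  by rewrite /q raddf_sum.
rewrite /trace_dist.
have -> : sigma ^⊗ m - q *: sigma ^⊗ m + P - sigma ^⊗ m = P - q *: sigma ^⊗ m.
  by rewrite addrAC [X in X + P]addrAC subrr add0r addrC.
have := trace_norm_subr_le pP (psdZ q0 psm).
rewrite mxtraceZ tsm mulr1 trP; lra.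
Qed.

(** The error is at most a finite sum of geometric sequences whose ratios do not depend on [r]. *)
Lemma achievable_rate_sub (r : R) : 0 <= r ->
  sym_subgroup U rho \subset sym_subgroup U' sigma ->
  achievable_rate U U' rho sigma r.
Proof.
move=> r0 sub; split=> //.
exists (fun n => vote_channel n (Num.truncn (r * n%:R))); split=> [n|].
  by split; [exact: vote_channel_cptp|exact: vote_channel_covariant].
pose err n := \sum_(g | g \notin sym_subgroup U rho)
     complex.Re (\tr (vote_effect U rho n g *m rho ^⊗ n)).
have err0 : (err n @[n --> \oo] --> (0 : R))%classic.
  have <- : \sum_(g | g \notin sym_subgroup U rho) 0 = 0 :> R by rewrite big1.
  apply: cvg_big => [|g gS]; first exact: add_continuous.
  have [c /andP[c0 c1] pc] := vote_effect_error pU st_rho gS.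
  apply: (@squeeze_cvgr _ _ _ _ (fun=> 0) (fun n => c ^+ n)).
  - apply: nearW => n; rewrite pc andbT -[0]/(complex.Re (0 : C)); apply: ler_Re.
    apply: psd_mxtrace_mulmx_ge0; first exact: psd_vote_effect.
    by apply: psd_ntens; case: st_rho.
  - exact: cvg_cst.
  - by apply: cvg_expr; rewrite ger0_norm.
apply: (@squeeze_cvgr _ _ _ _ (fun=> 0) err) => //; last exact: cvg_cst.
apply: nearW => n; rewrite vote_channel_error // andbT.
by rewrite mulr_ge0 ?invr_ge0 ?trace_norm_ge0.
Qed.

End Achievability.

(** * Converse, and achievability of rate zero *)

Lemma mxtrace_cyclic (K : comNzRingType) n (A Y V D : 'M[K]_n) :
  \tr (A *m Y *m V *m D) = \tr (Y *m (V *m D *m A)).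
Proof. by rewrite -!mulmxA mxtrace_mulC !mulmxA. Qed.

Lemma trace_distxx (R : realType) n (A : 'M[R[i]]_n) : trace_dist A A = 0.
Proof.
rewrite /trace_dist subrr; apply/eqP; rewrite mulf_eq0; apply/orP; right.
rewrite eq_le trace_norm_ge0 andbT.
by have := trace_norm_subr_le (@psd0 R n) (@psd0 R n); rewrite subr0 mxtrace0 addr0.
Qed.

Section Converse.
Variables (R : realType) (G : finGroupType) (d d' : nat).
Local Notation C := R[i].
Variables (U : G -> 'M[C]_d) (U' : G -> 'M[C]_d').
Variables (rho : 'M[C]_d) (sigma : 'M[C]_d').
Hypotheses (pU : projective_unitary_rep U) (pU' : projective_unitary_rep U').
Hypotheses (st_rho : is_state rho) (st_sigma : is_state sigma).

(* A contraction acting on the first tensor factor tells [sigma^m] from its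
   [g]-translate with an advantage independent of [m]. *)
Lemma covariant_trace_norm_ge n m (E : 'M[C]_(d ^ n) -> 'M[C]_(d' ^ m)) g :
  (0 < m)%N -> covariant U U' E -> g \in sym_subgroup U rho ->
  trace_norm (sigma - conj_rep U' sigma g) <=
  2 * trace_norm (E (rho ^⊗ n) - sigma ^⊗ m).
Proof.
case: m E => // m E _ covE; rewrite sym_subgroupP => /eqP gS.
set tau := E _; set D := tau - _; pose V := U' g ^⊗ m.+1.
have Vu : V \is unitarymx by apply: ntensmx_unitary; exact: (proj1 pU').
have V'u : V^t* \is unitarymx by rewrite trmxC_unitary.
(* Covariance transports the [g]-invariance of [rho ^⊗ n] to the output. *)
have tauV : V *m tau *m V^t* = tau.
  by rewrite /V adjmx_ntens -covE -ntensmx_conj -/(conj_rep U rho g) gS.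
have [X cX eX] := trace_norm_attained (sigma - conj_rep U' sigma g).
pose Y : 'M[C]_(d' ^ m.+1) := castS (X ⊗ 1%:M).
have cY : contrmx Y by apply/contrmx_castmx/contrmx_tens1.
have trY A : \tr A = 1 -> \tr (Y *m A ^⊗ m.+1) = \tr (X *m A).
  move=> A1; rewrite ntensmxS /Y /castS -castmx_mulmx mxtrace_castmx.
  rewrite mxtens.tensmx_mul mul1mx mxtrace_tens mxtrace_ntens A1 expr1n.
  exact: mulr1.
(* Since [V] fixes [tau], the target minus its translate is [- D] plus the conjugate of [D] by [V].
   Moving this conjugation onto [Y] tests [D] against two contractions, hence the factor 2. *)
have dE : \tr (X *m (sigma - conj_rep U' sigma g)) =
    \tr ((- Y) *m D) + \tr ((V^t* *m Y *m V) *m D).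
  have st_g := is_state_conj_rep pU' g st_sigma.
  rewrite mulmxBr mxtraceB -trY ?(proj2 st_sigma) // -trY ?(proj2 st_g) //.
  rewrite ntensmx_conj -adjmx_ntens -/V.
  have -> : \tr (V^t* *m Y *m V *m D) = \tr (Y *m (V *m D *m V^t*)).
    exact: mxtrace_cyclic.
  rewrite /D mulNmx -mulmxN opprB !(mulmxBr, mulmxBl) tauV !mxtraceB.
  by rewrite addrA subrK.
have -> : trace_norm (sigma - conj_rep U' sigma g) =
    complex.Re (\tr (X *m (sigma - conj_rep U' sigma g))) by rewrite eX.
rewrite dE raddfD mulr_natl mulr2n; apply: lerD.
  exact: contrmx_trace_norm_le (contrmx_opp cY).
apply/contrmx_trace_norm_le/contrmx_mul; last exact: contrmx_unitary Vu.
exact: contrmx_mul (contrmx_unitary V'u) cY.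
Qed.

(** At a positive rate some output copy is eventually required, and then the invariant output stays
    at a fixed distance from the target. *)
Lemma achievable_rate_le0 (r : R) :
  ~~ (sym_subgroup U rho \subset sym_subgroup U' sigma) ->
  achievable_rate U U' rho sigma r -> r <= 0.
Proof.
move=> /subsetPn[g gr gs] [r0 [E [cE limE]]]; rewrite leNgt; apply/negP => rp.
pose delta := trace_norm (sigma - conj_rep U' sigma g).
have delta0 : 0 < delta.
  apply: trace_norm_gt0; rewrite subr_eq0 eq_sym.
  by move: gs; rewrite sym_subgroupP.
(* The 4 combines the factor 2 of [covariant_trace_norm_ge] with the one half in [trace_dist]. *)
have e0 : 0 < delta / 4 by rewrite divr_gt0.
move/cvgrPdist_lt: limE => /(_ _ e0)[N _ HN].
(* Beyond [r^-1] at least one output copy is required. *)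
pose n := maxn N (Num.truncn r^-1).+1.
have := HN n (leq_maxl _ _); rewrite /= sub0r normrN => hn.
have m0 : (0 < Num.truncn (r * n%:R))%N.
  rewrite truncn_gt0 -ler_pdivrMl // mulr1.
  apply: ltW; apply: lt_le_trans (truncnS_gt _) _.
  by rewrite ler_nat leq_maxr.
have := covariant_trace_norm_ge m0 (proj2 (cE n)) gr.
rewrite -/delta => hd.
have : trace_dist (E n (rho ^⊗ n)) (sigma ^⊗ Num.truncn (r * n%:R)) < delta / 4.
  by apply: le_lt_trans hn; apply: ler_norm.
rewrite /trace_dist; lra.
Qed.

(** With no output copy the target space is one-dimensional, and the trace, a measurement with a
    single outcome, is exact. The equation on [m] allows sizes that are only provably [0], such as
    [Num.truncn (0 * n%:R)]. *)
Lemma trace_channel n m : m = 0%N ->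
  exists E : {linear 'M[C]_(d ^ n) -> 'M[C]_(d' ^ m)},
    [/\ cptp E, covariant U U' E &
        trace_dist (E (rho ^⊗ n)) (sigma ^⊗ m) = 0].
Proof.
move=> ->.
pose E : {linear 'M[C]_(d ^ n) -> 'M[C]_(d' ^ 0)} :=
  measure_prepare (fun _ : unit => 1%:M) (fun=> 1%:M).
have EE L : E L = (\tr L)%:M.
  rewrite /E /= /measure_prepare (bigD1 tt) //= big1 => [|[]] //.
  by rewrite addr0 mul1mx scalemx1.
exists E; split.
- apply: measure_prepare_cptp => [_||_]; first exact: psd_1.
    by rewrite (bigD1 tt) //= big1 ?addr0 => [|[]].
  by split; [exact: psd_1 | rewrite mxtrace1].
- move=> g L; rewrite !EE !mxtens.ntensmx0 mul1mx mulmx1.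
  have /unitarymxP/mulmx1C e : (U g) ^⊗ n \is unitarymx.
    by apply: ntensmx_unitary; exact: (proj1 pU).
  by rewrite mxtrace_mulC mulmxA -adjmx_ntens e mul1mx.
- by rewrite EE (proj2 (is_state_ntens n st_rho)) trace_distxx.
Qed.

Lemma achievable_rate0 : achievable_rate U U' rho sigma 0.
Proof.
split=> //.
have m0 n : Num.truncn (0 * n%:R : R) = 0%N by rewrite mul0r truncn0.
pose E n := projT1 (cid (trace_channel n (m0 n))).
exists E; split=> [n|].
  by rewrite /E; case: cid => F [].
rewrite (_ : (fun n => _) = fun=> 0); first exact: cvg_cst.
by apply/funext => n; rewrite /E; case: cid => F [].
Qed.

End Converse.

Theorem theorem2 (R : realType) (G : finGroupType) (d d' : nat)
    (U : G -> 'M[R[i]]_d) (U' : G -> 'M[R[i]]_d')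
    (rho : 'M[R[i]]_d) (sigma : 'M[R[i]]_d') :
  projective_unitary_rep U -> projective_unitary_rep U' ->
  is_state rho -> is_state sigma ->
  conversion_rate U U' rho sigma =
    if sym_subgroup U rho \subset sym_subgroup U' sigma then +oo%E else 0%E.
Proof.
move=> pU pU' st_rho st_sigma; rewrite /conversion_rate; case: ifPn => sub.
(* An extended real is [+oo] once it bounds every positive real from above. *)
- apply/eqyP => r r0; apply: ereal_sup_ubound; exists r => //.
  by apply: achievable_rate_sub => //; exact: ltW.
- apply/eqP; rewrite eq_le; apply/andP; split.
    apply: ge_ereal_sup => _ [r ar <-]; rewrite lee_fin.
    exact: (achievable_rate_le0 pU' st_sigma sub ar).
  (* The supremum of an empty set would be [-oo], so the lower bound needs a rate that is actually
     achieved. *)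
  by apply: ereal_sup_ubound; exists 0 => //; exact: achievable_rate0.
Qed.
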